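(* Let $n\in\mathbb N$, $\varepsilon>0$, and let $x=\sum_{k=1}^mc_kx_k$ be a $(n,\varepsilon)$ special convex combination in $\mathfrak X$ such that $\|x_k\|\le1$ for $k=1,\dots,m$. If $F\subset\{1,\dots,m\}$, then $$\Big\|\sum_{k\in F}c_kx_k\Big\|\le\frac{6}{2^n}\sum_{k\in F}c_k+12\varepsilon.$$ In particular, $\|x\|\le\frac6{2^n}+12\varepsilon$.
   Context: Notation. Scalars are real; $\mathbb N=\{1,2,\dots\}$. $c_{00}$ is the space of finitely supported real sequences with unit vectors $e_n$; for $f,x\in c_{00}$, $f(x)=\sum_if(i)x(i)$; $\operatorname{supp}x=\{i:x(i)\neq0\}$; $\operatorname{ran}x$ is the smallest interval of $\mathbb N$ containing $\operatorname{supp}x$; $x<y$ means $\max\operatorname{supp}x<\min\operatorname{supp}y$; $If$ is the restriction of $f$ to $I\subset\mathbb N$. Schreier families: $\mathcal S_0=\{\{n\}:n\in\mathbb N\}$, $\mathcal S_1=\{F\subset\mathbb N:\#F\le\min F\}$, $\mathcal S_{n+1}=\{\bigcup_{j=1}^kF_j: F_1<\dots<F_k\in\mathcal S_n,\ k\le\min F_1\}$. Vectors $x_1<\dots<x_k$ are $\mathcal S_n$-admissible if $\{\min\operatorname{supp}x_i:i\le k\}\in\mathcal S_n$. The space $\mathfrak X$. Fix an infinite set $L=\{\ell_k:k\in\mathbb N\}\subset\mathbb N$ with $\ell_1>2$, $\ell_{k+1}>2^{2\ell_k}$, $\sum_k2^{-\ell_k}<\frac1{1000}$, a partition of $L$ into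 infinite sets $L_1,L_2$, and a one-to-one map $\sigma:\mathcal Q\to L_2$ with $\sigma((f_1,n_1),\dots,(f_m,n_m))>2^{n_m}\max\operatorname{supp}f_m$, where $\mathcal Q$ is the set of finite sequences $((f_1,n_1),\dots,(f_m,n_m))$ with $n_k\in\mathbb N$ and $f_1<\dots<f_m$ in $c_{00}$ with rational coordinates. $W$ is the smallest subset of $c_{00}$ such that: (1) $\pm e_n\in W$ (type 0 functionals); $W$ is closed under $f\mapsto-f$, restriction to intervals, and rational convex combinations. (2) $W$ contains every $f=\frac1{2^n}\sum_{j=1}^d\alpha_j$ with $\{\alpha_j\}_{j=1}^d$ an $\mathcal S_n$-admissible very fast growing sequence of $\alpha$-averages in $W$; $g=\pm If$, $I$ an interval, is called of type I$_\alpha$ with weight $w(g)=n$. (3) The same with $\beta$-averages in place of $\alpha$-averages, giving functionals of type I$_\beta$ with weight $n$. (4) $W$ contains every $f=\frac12\sum_{j=1}^df_j$ with $\{f_j\}_{j=1}^d$ an $\mathcal S_1$-admissible special sequence of type I$_\alpha$ functionals, i.e. $w(f_1)\in L_1$ and $w(f_j)=\sigma((f_1,w(f_1)),\dots,(f_{j-1},w(f_{j-1})))$ for $j>1$; $g=\pm If$, $I$ an interval, is called of type II with weights $\widehat w(g)=\{w(f_j):\operatorname{ran}f_j\cap I\neq\varnothing\}$. Here an $\alpha$-average of size $s(\alpha)=n$ is $\alpha=\frac1n\sum_{j=1}^df_j\in W$ with $d\le n$, $f_1<\dots<f_d$ in $W$; a $\beta$-average of size $s(\beta)=n$ is $\beta=\frac1n\sum_{j=1}^df_j\in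 W$ with $d\le n$ and $f_j\in W$ of type II with pairwise disjoint weights $\widehat w(f_j)$. A sequence of averages $f_1<f_2<\cdots$ is very fast growing if $s(f_j)>2^{\max\operatorname{supp}f_{j-1}}$ and $s(f_j)>s(f_{j-1})$ for $j>1$. The norm is $\|x\|=\sup\{f(x):f\in W\}$ on $c_{00}$, and $\mathfrak X$ is the completion. Special convex combinations. $\sum_{k\in F}c_ke_k$ is a $(n,\varepsilon)$ basic special convex combination if $F\in\mathcal S_n$, $c_k\ge0$, $\sum_{k\in F}c_k=1$, and $\sum_{k\in G}c_k<\varepsilon$ for every $G\subset F$ with $G\in\mathcal S_{n-1}$. For $x_1<\dots<x_m$ in $c_{00}$, $\sum_{k=1}^mc_kx_k$ is a $(n,\varepsilon)$ special convex combination if $\sum_{k=1}^mc_ke_{\psi(k)}$, $\psi(k)=\min\operatorname{supp}x_k$, is a $(n,\varepsilon)$ basic special convex combination. *)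

(* Defs.v *)
From mathcomp Require Import all_boot all_order all_algebra finmap.
From mathcomp Require Import all_classical all_reals all_analysis.

Set Implicit Arguments.
Unset Strict Implicit.
Unset Printing Implicit Defensive.

Import Order.TTheory GRing.Theory Num.Theory.
Import numFieldNormedType.Exports.

Local Open Scope classical_set_scope.
Local Open Scope ring_scope.

(* Throughout, N = {1, 2, ...}: coordinate 0 of a sequence x : R^nat is unused
   and required to vanish on c00. *)

Definition c00 (R : realType) : set R^nat :=
  [set x | x 0%N = 0 /\ finite_set [set i | x i != 0]].
Arguments c00 : clear implicits.

Definition unitv (R : realType) (n : nat) : R^nat := fun i => (i == n)%:R.
Arguments unitv : clear implicits.

Definition pairing (R : realType) (f x : R^nat) : R :=
  \sum_(i \in [set: nat]) f i * x i.

(* fset0 when the support is infinite *)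
Definition supp (R : realType) (x : R^nat) : {fset nat} :=
  fset_set [set i | x i != 0].

(* both are 0 on fset0 *)
Definition fmax (F : {fset nat}) : nat := (\max_(i <- F) i)%N.
Definition fmin (F : {fset nat}) : nat := \big[minn/fmax F]_(i <- F) i.

Definition maxsupp (R : realType) (x : R^nat) : nat := fmax (supp x).
Definition minsupp (R : realType) (x : R^nat) : nat := fmin (supp x).

Definition ran (R : realType) (x : R^nat) : set nat :=
  \bigcap_(I in [set I : interval nat | {subset supp x <= I}]) [set` I].

Definition restr (R : realType) (I : interval nat) (f : R^nat) : R^nat :=
  fun i => if i \in I then f i else 0.

(* x_1 < ... < x_k, which presupposes that the vectors are nonzero *)
Definition block (R : realType) (s : seq R^nat) : bool :=
  all (fun x => supp x != fset0) s &&
  sorted (fun x y => maxsupp x < minsupp y)%N s.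

(* The members of the Schreier families are taken to be nonempty. *)
Fixpoint schreier (n : nat) (F : {fset nat}) : Prop :=
  match n with
  | 0 => exists2 k : nat, (0 < k)%N & F = [fset k]%fset
  | 1 => F != fset0 /\ (#|` F| <= fmin F)%N
  | n'.+1 => exists Fs : seq {fset nat},
      [/\ Fs != [::],
          sorted (fun G H => fmax G < fmin H)%N Fs,
          forall G, G \in Fs -> schreier n' G,
          (size Fs <= fmin (head fset0 Fs))%N
        & F = (\bigcup_(G <- Fs) G)%fset]
  end.

Definition admissible (R : realType) (n : nat) (s : seq R^nat) : Prop :=
  block s /\ schreier n [fset minsupp x | x in s]%fset.

(* the set Q of finite sequences ((f_1, n_1), ..., (f_m, n_m)), m >= 1 *)
Definition coding_domain (R : realType) : set (seq (R^nat * nat)) :=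
  [set s | [/\ s != [::],
               block (unzip1 s),
               forall p, p \in s -> (0 < p.2)%N
             & forall p, p \in s ->
                 c00 R p.1 /\ (forall i, exists q : rat, p.1 i = ratr q)]].
Arguments coding_domain : clear implicits.

(* ell is indexed from 0, i.e. ell k stands for l_{k+1}. *)
Record coding_data (R : realType) := CodingData {
  ell : nat -> nat;
  L1 : set nat;
  L2 : set nat;
  sigma : seq (R^nat * nat) -> nat;
  ell_gt2 : (2 < ell 0)%N;
  ell_growth : forall k, (2 ^ (2 * ell k) < ell k.+1)%N;
  ell_sum : (\sum_(0 <= k <oo) ((2 ^- ell k : R)%:E) < (1000^-1 : R)%:E)%E;
  L1_infinite : infinite_set L1;
  L2_infinite : infinite_set L2;
  L12_disjoint : L1 `&` L2 = set0;
  L12_cover : L1 `|` L2 = range ell;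
  sigma_L2 : forall s, coding_domain R s -> L2 (sigma s);
  sigma_inj : {in coding_domain R &, injective sigma};
  sigma_growth : forall s p, coding_domain R (rcons s p) ->
    (2 ^ p.2 * maxsupp p.1 < sigma (rcons s p))%N
}.

(* In the definitions below V is a candidate for the norming set W.  Sizes and
   weights depend on the chosen representation of a functional, so they are
   recorded by relations rather than by functions. *)

Definition alpha_average (R : realType) (V : set R^nat) (n : nat)
    (a : R^nat) : Prop :=
  [/\ (0 < n)%N, V a & exists fs : seq R^nat,
    [/\ (size fs <= n)%N,
        forall f, f \in fs -> V f,
        block fs
      & a = n%:R^-1 *: \sum_(f <- fs) f]].

Definition very_fast_growing (R : realType) (s : seq (R^nat * nat)) : bool :=
  block (unzip1 s) &&
  sorted (fun p q => (2 ^ maxsupp p.1 < q.2) && (p.2 < q.2))%N s.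

Definition typeI_head (R : realType) (average : nat -> R^nat -> Prop)
    (n : nat) (f : R^nat) : Prop :=
  (0 < n)%N /\ exists s : seq (R^nat * nat),
    [/\ forall p, p \in s -> average p.2 p.1,
        admissible n (unzip1 s),
        very_fast_growing s
      & f = 2 ^- n *: \sum_(p <- s) p.1].

Definition pm_restr (R : realType) (f g : R^nat) (I : interval nat) : Prop :=
  g = restr I f \/ g = - restr I f.

Definition typeI (R : realType) (average : nat -> R^nat -> Prop)
    (n : nat) (g : R^nat) : Prop :=
  exists f I, typeI_head average n f /\ pm_restr f g I.

Definition typeI_alpha (R : realType) (V : set R^nat) :=
  typeI (alpha_average V).

Definition special (R : realType) (D : coding_data R) (V : set R^nat)
    (s : seq (R^nat * nat)) : Prop :=
  [/\ block (unzip1 s),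
      forall p, p \in s -> V p.1 /\ typeI_alpha V p.2 p.1,
      (0 < size s)%N -> L1 D (nth 0 (unzip2 s) 0)%N
    & forall j, (0 < j < size s)%N ->
        nth 0%N (unzip2 s) j = sigma D (take j s)].

Definition typeII_head (R : realType) (D : coding_data R) (V : set R^nat)
    (s : seq (R^nat * nat)) (f : R^nat) : Prop :=
  [/\ special D V s,
      admissible 1 (unzip1 s)
    & f = 2^-1 *: \sum_(p <- s) p.1].

Definition typeII (R : realType) (D : coding_data R) (V : set R^nat)
    (w : set nat) (g : R^nat) : Prop :=
  exists s f I, [/\ typeII_head D V s f, pm_restr f g I
    & w = [set k | exists p, [/\ p \in s, p.2 = k
                               & ran p.1 `&` [set` I] !=set0]]].

Definition beta_average (R : realType) (D : coding_data R) (V : set R^nat)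
    (n : nat) (b : R^nat) : Prop :=
  [/\ (0 < n)%N, V b & exists d (f : 'I_d -> R^nat) (w : 'I_d -> set nat),
    [/\ (d <= n)%N,
        forall j, V (f j) /\ typeII D V (w j) (f j),
        trivIset setT w
      & b = n%:R^-1 *: \sum_j f j]].

Definition typeI_beta (R : realType) (D : coding_data R) (V : set R^nat) :=
  typeI (beta_average D V).

Record norming_closed (R : realType) (D : coding_data R) (V : set R^nat) :
    Prop := NormingClosed {
  closed_c00 : V `<=` c00 R;
  closed_unit : forall n, (0 < n)%N -> V (unitv R n) /\ V (- unitv R n);
  closed_opp : forall f, V f -> V (- f);
  closed_restr : forall I f, V f -> V (restr I f);
  closed_conv : forall d (q : 'I_d -> rat) (f : 'I_d -> R^nat),
    (forall j, 0 <= q j) -> \sum_j q j = 1 -> (forall j, V (f j)) ->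
    V (\sum_j (ratr (q j) : R) *: f j);
  closed_Ialpha : forall n f, typeI_head (alpha_average V) n f -> V f;
  closed_Ibeta : forall n f, typeI_head (beta_average D V) n f -> V f;
  closed_II : forall s f, typeII_head D V s f -> V f
}.

Definition W (R : realType) (D : coding_data R) : set R^nat :=
  smallest (norming_closed D) set0.

(* the norm of the space, on the dense subspace c00 *)
Definition Xnorm (R : realType) (D : coding_data R) (x : R^nat) : R :=
  sup [set pairing f x | f in W D].

Definition basic_scc (R : realType) (n : nat) (eps : R) (F : {fset nat})
    (c : nat -> R) : Prop :=
  [/\ schreier n F,
      forall k, k \in F -> 0 <= c k,
      \sum_(k <- F) c k = 1
    & forall G : {fset nat}, (G `<=` F)%fset -> schreier n.-1 G ->
        \sum_(k <- G) c k < eps].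

(* The coefficients of the basic special convex combination are the coordinates
   of the vector \sum_k c_k e_(psi k); psi is injective as x is a block. *)
Definition scc (R : realType) (n : nat) (eps : R) (m : nat)
    (c : 'I_m -> R) (x : 'I_m -> R^nat) : Prop :=
  [/\ forall k, c00 R (x k),
      block [seq x k | k : 'I_m]
    & basic_scc n eps [fset minsupp (x k) | k : 'I_m]%fset
        (\sum_k c k *: unitv R (minsupp (x k)))].

(* Main.v *)
(* Write p_k = min supp x_k and let M_N(A) be the largest sum of the c_k, k in G,
   over the G in A whose positions p_k form an S_N set.  For every f in W, interval
   I, depth N and index set A,
     |(If)(\sum_{k in A} c_k x_k)| <= 2^-N \sum_{k in A} c_k + 4 M_N(A).
   The right-hand side does not depend on f, so the bound survives convex
   combinations, in particular averages; every other functional is a tree of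
   half-sums over S_1-admissible families.  For f = (f_1 + ... + f_d) / 2, the x_k
   cut by some min supp f_j cost at most their coefficient, and their positions
   form an S_1 set once the first one is dropped; the other x_k split into groups,
   each acted on by a single f_j, to which the bound at depth N - 1 applies.
   At depth n - 1, M_{n-1} is at most eps by the definition of an (n, eps) special
   convex combination. *)

Require Import Defs.
From mathcomp Require Import all_boot all_order all_algebra finmap.
From mathcomp Require Import all_classical all_reals all_analysis.
From mathcomp Require Import zify ring lra.
Import Order.TTheory GRing.Theory Num.Theory.
Import numFieldNormedType.Exports.
Local Open Scope classical_set_scope.
Local Open Scope ring_scope.

Set Implicit Arguments.
Unset Strict Implicit.
Unset Printing Implicit Defensive.

(** * Minima, maxima and Schreier sets *)

Lemma leq_fmax (F : {fset nat}) i : i \in F -> (i <= fmax F)%N.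
Proof. by move=> iF; rewrite /fmax; apply: (@leq_bigmax_seq _ _ xpredT id). Qed.

Lemma fmin_leq (F : {fset nat}) i : i \in F -> (fmin F <= i)%N.
Proof.
have leq_min z (s : seq nat) : i \in s -> (\big[minn/z]_(j <- s) j <= i)%N.
  elim: s => // j s IH; rewrite inE big_cons => /orP[/eqP->|/IH].
    exact: geq_minl.
  by apply: leq_trans; exact: geq_minr.
exact: leq_min.
Qed.

Lemma fmin_in (F : {fset nat}) : F != fset0 -> fmin F \in F.
Proof.
have min_mem z (s : seq nat) : \big[minn/z]_(j <- s) j \in z :: s.
  elim: s => [|j s IH]; first by rewrite big_nil mem_head.
  rewrite big_cons /minn; case: ifP => _; first by rewrite !inE eqxx orbT.
  by move: IH; rewrite !inE => /orP[->|->]; rewrite ?orbT.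
case/fset0Pn => i iF; have := min_mem (fmax F) (enum_fset F).
rewrite -/(fmin F) inE => /orP[/eqP eq_max|//].
suff -> : fmin F = i by [].
by apply/eqP; rewrite eqn_leq fmin_leq// eq_max leq_fmax.
Qed.

Lemma schreier_neq0 n F : schreier n F -> F != fset0.
Proof.
elim: n F => [|[|n] IH] F /=.
- by case=> k _ ->; apply/fset0Pn; exists k; rewrite inE.
- by case.
- case=> -[|G Fs] [] // _ _ sFs _ ->; have /IH/fset0Pn[i iG] := sFs G (mem_head _ _).
  by apply/fset0Pn; exists i; apply/bigfcupP; exists G; rewrite ?mem_head.
Qed.

Lemma schreier1 (F : {fset nat}) : F != fset0 ->
  (forall i, i \in F -> (#|` F| <= i)%N) -> schreier 1 F.
Proof. by move=> F0 hF; split=> //; apply/hF/fmin_in. Qed.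

(** [schreier] introduces S_1 by cardinality, so for [n = 0] a union of singletons has to be
    counted; for larger [n] the union is the definition itself. *)
Lemma schreierS n (Fs : seq {fset nat}) :
  Fs != [::] -> sorted (fun G H => fmax G < fmin H)%N Fs ->
  (forall G, G \in Fs -> schreier n G) ->
  (forall G i, G \in Fs -> i \in G -> (size Fs <= i)%N) ->
  schreier n.+1 (\bigcup_(G <- Fs) G)%fset.
Proof.
move=> Fs0 sFs schFs szFs.
have hFs : head fset0 Fs \in Fs by case: Fs Fs0 {sFs schFs szFs} => // *; exact: mem_head.
case: n schFs => [|n] schFs; last first.
  exists Fs; split=> //; apply: (szFs _ _ hFs); apply: fmin_in.
  exact: schreier_neq0 (schFs _ hFs).
apply: schreier1.
  have /fset0Pn[i ih] := schreier_neq0 (schFs _ hFs).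
  apply/fset0Pn; exists i; apply/bigfcupP; exists (head fset0 Fs) => //.
  by rewrite hFs.
move=> i /bigfcupP[G /andP[GFs _] iG]; apply: leq_trans (szFs _ _ GFs iG).
elim: Fs schFs {Fs0 sFs szFs hFs GFs} => [|H Fs IH] sch.
  by rewrite big_nil cardfs0.
rewrite big_cons /=; apply: leq_trans (leq_card_fsetU _ _) _.
have [k _ ->] := sch H (mem_head _ _).
by rewrite cardfs1 add1n ltnS IH// => K KFs; apply: sch; rewrite inE KFs orbT.
Qed.

Lemma schreier_succ n (F : {fset nat}) : (forall i, i \in F -> (0 < i)%N) ->
  schreier n F -> schreier n.+1 F.
Proof.
move=> F_gt0 schF; have := @schreierS n [:: F]; rewrite big_seq1; apply=> //.
  by move=> G; rewrite inE => /eqP->.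
by move=> G i; rewrite inE => /eqP->; exact: F_gt0.
Qed.

Lemma fmax_lt_fmin (G H : {fset nat}) : G != fset0 -> H != fset0 ->
  (forall i j, i \in G -> j \in H -> (i < j)%N) -> (fmax G < fmin H)%N.
Proof.
move=> /fset0Pn[i iG] /fmin_in jH ltGH.
rewrite -(prednK (leq_ltn_trans (leq0n i) (ltGH _ _ iG jH))) ltnS.
apply/bigmax_leqP_seq => k kG _.
by have := ltGH k _ kG jH; lia.
Qed.

(** * Largest mass of a Schreier subset, and the estimate for half-sums *)

Section Mass.
Variables (R : realType) (m : nat) (p : 'I_m -> nat) (c : 'I_m -> R).
Hypotheses (c_ge0 : forall k, 0 <= c k) (p_gt0 : forall k, (0 < p k)%N).

Definition small n (G : {set 'I_m}) : Prop :=
  G = finset.set0 \/ schreier n [fset p k | k in G]%fset.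

(** A set attaining M_n(A): the maximizers of several index sets can then be glued together. *)
Definition heavy n (A : {set 'I_m}) : {set 'I_m} :=
  [arg max_(G > finset.set0 | (G \subset A) && `[< small n G >])
     \sum_(k in G) c k]%O.

Definition mass n A : R := \sum_(k in heavy n A) c k.

Lemma heavy_small n A : heavy n A \subset A /\ small n (heavy n A).
Proof.
rewrite /heavy; case: arg_maxP => [|G /andP[? /asboolP]]//.
by rewrite finset.sub0set; apply/asboolP; left.
Qed.

Lemma le_mass n (A G : {set 'I_m}) : G \subset A -> small n G ->
  \sum_(k in G) c k <= mass n A.
Proof.
move=> GA sG; rewrite /mass /heavy; case: arg_maxP => [|H _]; last first.
  by apply; rewrite GA; apply/asboolP.
by rewrite finset.sub0set; apply/asboolP; left.
Qed.

Lemma mass_ge0 n A : 0 <= mass n A. Proof. exact: sumr_ge0. Qed.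

Lemma small_succ n G : small n G -> small n.+1 G.
Proof.
case=> [->|sG]; [by left|right; apply: schreier_succ sG].
by move=> i /imfsetP[k _ ->].
Qed.

Lemma mass_le n n' A : (n <= n')%N -> mass n A <= mass n' A.
Proof.
move=> /subnK <-; elim: (n' - n)%N => // l IH; apply: (le_trans IH).
have [hA sA] := heavy_small (l + n) A.
by apply: le_mass => //; exact: small_succ.
Qed.

Lemma sum_ordered d (F : 'I_m -> R) (A : 'I_d -> {set 'I_m}) :
  (forall (i j : 'I_d) k l, (i < j)%N -> k \in A i -> l \in A j -> (p k < p l)%N) ->
  \sum_(k in (\bigcup_j A j)%SET) F k = \sum_j \sum_(k in A j) F k.
Proof.
move=> ltA; apply: partition_disjoint_bigcup => i j neq_ij; apply/pred0P => k /=.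
apply/negP => /andP[ki kj].
by case: (ltngtP i j) neq_ij => [ij|ji|/val_inj->]; rewrite ?eqxx// => _;
  [have := ltA _ _ _ _ ij ki kj|have := ltA _ _ _ _ ji kj ki]; rewrite ltnn.
Qed.

(** The maximizers of the A_j have successive position sets in S_n; there are at most d of them and
    all positions are at least d, so their union is an S_{n+1} set. *)
Lemma sum_mass_le n d (A : 'I_d -> {set 'I_m}) (B : {set 'I_m}) :
  (forall j, A j \subset B) ->
  (forall (i j : 'I_d) k l, (i < j)%N -> k \in A i -> l \in A j -> (p k < p l)%N) ->
  (forall j k, k \in A j -> (d <= p k)%N) ->
  \sum_j mass n (A j) <= mass n.+1 B.
Proof.
move=> AB ltA dA.
pose H j := heavy n (A j).
have HA j k : k \in H j -> k \in A j by have [/fintype.subsetP + _] := heavy_small n (A j); exact.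
rewrite -[X in X <= _](@sum_ordered _ c H); last first.
  by move=> i j k l ij /HA ki /HA lj; exact: ltA ij ki lj.
apply: le_mass.
  apply/finset.bigcupsP => j _; apply: fintype.subset_trans (AB j).
  by have [] := heavy_small n (A j).
have [H0|[k kH]] := finset.set_0Vmem (\bigcup_j H j)%SET; first by left.
right.
pose pH j := [fset p k | k in H j]%fset.
(* Empty maximizers are discarded, because the pieces of a Schreier union must be nonempty. *)
pose s := [seq j <- enum 'I_d | H j != finset.set0].
have sP j : (j \in s) = (H j != finset.set0) by rewrite mem_filter mem_enum andbT.
have -> : [fset p k | k in (\bigcup_j H j)%SET]%fset = (\bigcup_(G <- map pH s) G)%fset.
  apply/fsetP => i; apply/imfsetP/bigfcupP => /= [[l /finset.bigcupP[j _ lj] ->]|].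
    exists (pH j); last by apply/imfsetP; exists l.
    rewrite andbT; apply/mapP; exists j => //; rewrite sP.
    by apply/finset.set0Pn; exists l.
  move=> [_ /andP[/mapP[j _ ->] _] /imfsetP[l /= lj ->]]; exists l => //.
  by apply/finset.bigcupP; exists j.
have pH0 j : j \in s -> pH j != fset0.
  rewrite sP => /finset.set0Pn[l lj]; apply/fset0Pn; exists (p l).
  by apply/imfsetP; exists l.
apply: schreierS.
- apply/eqP => s0; move: kH => /finset.bigcupP[j _ kj].
  suff: pH j \in map pH s by rewrite s0.
  by apply: map_f; rewrite sP; apply/finset.set0Pn; exists k.
- apply: pairwise_sorted; rewrite pairwise_map.
  have : pairwise (fun i j : 'I_d => i < j)%N s.
    apply: pairwise_filter; rewrite -sorted_pairwise; last by move=> ? ? ?; exact: ltn_trans.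
    by have := iota_ltn_sorted 0 d; rewrite -val_enum_ord sorted_map.
  apply: (sub_in_pairwise (P := mem s)); last by apply/allP.
  move=> i j si sj ij; apply: fmax_lt_fmin; [exact: pH0|exact: pH0|].
  by move=> _ _ /imfsetP[l /= /HA li ->] /imfsetP[l' /= /HA lj ->]; exact: ltA ij li lj.
- move=> _ /mapP[j js ->]; have [_ [H0|//]] := heavy_small n (A j).
  by move: js; rewrite sP /H H0 eqxx.
- move=> _ i /mapP[j js ->] /imfsetP[l /= /HA lj ->].
  rewrite size_map; apply: leq_trans (dA j l lj).
  rewrite size_filter -[X in (_ <= X)%N](size_enum_ord d); exact: count_size.
Qed.

(** The constant 4 is the fixed point of t = 2 + t/2: a half-sum adds 2 masses for the cut vectors
    and halves the bound for the rest. *)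
Definition depth_bound n (A : {set 'I_m}) : R := 2 ^- n * \sum_(k in A) c k + 4 * mass n A.

Lemma sum_subset_le (A B : {set 'I_m}) : A \subset B ->
  \sum_(k in A) c k <= \sum_(k in B) c k.
Proof.
move=> /finset.setIidPr AB; rewrite [leRHS](big_setID A)/= AB lerDl.
exact: sumr_ge0.
Qed.

Lemma norm_sum_le (A : {set 'I_m}) (z : 'I_m -> R) : (forall k, k \in A -> `|z k| <= 1) ->
  `|\sum_(k in A) c k * z k| <= \sum_(k in A) c k.
Proof.
move=> z1; apply: le_trans (ler_norm_sum _ _ _) _; apply: ler_sum => k kA.
by rewrite normrM ger0_norm// ler_piMr// z1.
Qed.

Variable q : 'I_m -> nat.
Hypothesis qp : forall k l : 'I_m, (k < l)%N -> (q k < p l)%N.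

(** [p k] and [q k] model the ends of the support of x_k. The intervals (p k, q k] are disjoint, so
    each [a j] is straddled at most once. The first index k0 of B forms an S_0 set; the others have
    positions beyond [q k0], hence beyond some [a j >= d], and form an S_1 set. This gives the
    factor 2. *)
Lemma straddled_le n d (a : 'I_d -> nat) (B : {set 'I_m}) :
  (forall j, (d <= a j)%N) ->
  (forall k, k \in B -> exists j, (p k < a j <= q k)%N) ->
  \sum_(k in B) c k <= 2 * mass n.+1 B.
Proof.
move=> da Ba.
have [->|[k kB]] := finset.set_0Vmem B.
  by rewrite big_set0 mulr_ge0// mass_ge0.
have [k0 k0B k0min] := arg_minnP (fun k : 'I_m => k : nat) kB.
rewrite (big_setD1 k0)//= mulr_natl mulr2n lerD//.
  have -> : c k0 = \sum_(k in [set k0]%SET) c k by rewrite big_set1.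
  apply: le_trans (@mass_le 0 _ _ _) => //.
  apply: le_mass; first by rewrite finset.sub1set.
  right; exists (p k0) => //; apply/fsetP => i; rewrite inE.
  apply/imfsetP/eqP => [[l /= + ->]|->]; first by rewrite inE => /eqP->.
  by exists k0; rewrite //= inE.
have gt_k0 k1 : k1 \in (B :\ k0)%SET -> (k0 < k1)%N.
  rewrite !inE => /andP[k10 k1B]; rewrite ltn_neqAle eq_sym k10.
  exact: k0min.
apply: le_trans (@mass_le 1 n.+1 _ _) => //; apply: le_mass; first exact: finset.subD1set.
have [->|[l lB]] := finset.set_0Vmem (B :\ k0)%SET; [by left|right].
apply: schreier1; first by apply/fset0Pn; exists (p l); apply/imfsetP; exists l.
move=> _ /imfsetP[k1 /= k1B ->].
have [j0 /andP[_ j0q]] := Ba k0 k0B.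
have := leq_ltn_trans j0q (qp (gt_k0 _ k1B)); apply: leq_trans.
apply: leqW; apply: leq_trans (da j0); apply: leq_trans (leq_imfset_card _ _ _) _ => /=.
(* Since [f] takes values in [option 'I_d], injectivity gives only d + 1 as a bound for the size of
   B; removing [k0] brings it down to d. *)
pose f l := [pick j | (p l < a j <= q l)%N].
have f_inj : {in B &, injective f}.
  move=> i1 i2 /Ba[j1 j1P] /Ba[j2 j2P]; rewrite /f.
  case: pickP => [j /andP[pj jq] |/(_ j1)]; last by rewrite j1P.
  case: pickP => [j' /andP[pj' jq'] [jj']|//]; rewrite -{}jj' in pj' jq'.
  apply/val_inj; case: (ltngtP (val i1) (val i2)) => // /qp; lia.
have := max_card (mem (f @: B)%SET); rewrite card_in_imset// card_option card_ord.
by rewrite (cardsD1 k0) [k0 \in B]k0B ltnS cardE.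
Qed.

(** Here [y j k] models the action of f_j on x_k and [a j] a threshold below the support of f_j; a
    nonzero action forces x_k to reach [a j] and to start before every later threshold. *)
Lemma depth_bound_half d (a : 'I_d -> nat) (y : 'I_d -> 'I_m -> R) :
  (forall j, (d <= a j)%N) ->
  (forall j k, y j k != 0 ->
     (a j <= q k)%N /\ forall j' : 'I_d, (j < j')%N -> (p k < a j')%N) ->
  (forall k, `|2^-1 * \sum_j y j k| <= 1) ->
  (forall j n (A : {set 'I_m}), `|\sum_(k in A) c k * y j k| <= depth_bound n A) ->
  forall n (A : {set 'I_m}),
    `|\sum_(k in A) c k * (2^-1 * \sum_j y j k)| <= depth_bound n A.
Proof.
move=> da ya y1 yb [|n] A.
  (* At depth 0 the sum of the coefficients alone is an upper bound. *)
  rewrite /depth_bound expr0 invr1 mul1r; apply: le_trans (norm_sum_le _) _ => //.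
  by rewrite lerDl mulr_ge0// mass_ge0.
pose B := [set k in A | [exists j, (p k < a j <= q k)%N]]%SET.
pose C (j : 'I_d) := [set k in (A :\: B)%SET |
  (a j <= p k)%N && [forall j' : 'I_d, (j < j')%N ==> (p k < a j')%N]]%SET.
have BA : B \subset A by apply/fintype.subsetP => k; rewrite inE => /andP[].
have CA j : C j \subset A.
  by apply/fintype.subsetP => k; rewrite !inE => /andP[/andP[_]].
have ltC (i j : 'I_d) k l : (i < j)%N -> k \in C i -> l \in C j -> (p k < p l)%N.
  rewrite !inE => ij /and3P[_ _ /forallP/(_ j)/implyP/(_ ij) pka] /and3P[_ + _].
  exact: leq_trans.
have dC j k : k \in C j -> (d <= p k)%N.
  by rewrite !inE => /and3P[_ + _]; exact: leq_trans.
(* Off B, a nonzero [y j k] puts k in [C j]: otherwise [p k < a j <= q k], and k would be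
   straddled. *)
have -> : \sum_(k in A) c k * (2^-1 * \sum_j y j k) =
    \sum_(k in B) c k * (2^-1 * \sum_j y j k) +
    2^-1 * \sum_j \sum_(k in C j) c k * y j k.
  rewrite (big_setID B)/= (finset.setIidPr BA); congr +%R.
  under eq_bigr do rewrite mulrCA mulr_sumr.
  rewrite -mulr_sumr exchange_big/=; congr (_ * _); apply: eq_bigr => j _.
  rewrite [RHS]big_mkcond [LHS]big_mkcond/=; apply: eq_bigr => k _.
  case: ifPn => kAB; last first.
    by case: ifPn => //; rewrite inE (negbTE kAB).
  case: ifPn => // kC; apply/eqP; rewrite mulf_eq0; apply/orP; right.
  apply: contraNT kC => /ya[ajq pk]; rewrite inE kAB/=; apply/andP; split; last first.
    by apply/forallP => j'; apply/implyP; exact: pk.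
  rewrite leqNgt; apply/negP => pa; move: kAB; rewrite !inE => /andP[/negP + kA].
  by apply; rewrite kA; apply/existsP; exists j; rewrite pa.
apply: le_trans (ler_normD _ _) _.
have massB : `|\sum_(k in B) c k * (2^-1 * \sum_j y j k)| <= 2 * mass n.+1 A.
  apply: le_trans (norm_sum_le _) _ => //.
  apply: le_trans (straddled_le n da _) _.
    by move=> k; rewrite inE => /andP[_ /existsP].
  have [hB sB] := heavy_small n.+1 B.
  by rewrite ler_pM2l// le_mass// (fintype.subset_trans hB).
(* The C_j are disjoint, so their coefficient sums add up within A, and their masses at level n
   merge into one mass at level n + 1. *)
have massC : `|\sum_j \sum_(k in C j) c k * y j k| <=
    2 ^- n * \sum_(k in A) c k + 4 * mass n.+1 A.
  apply: le_trans (ler_norm_sum _ _ _) _.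
  apply: le_trans (ler_sum _ (fun j _ => yb j n (C j))) _.
  rewrite big_split/= -!mulr_sumr; apply: lerD; rewrite ler_pM2l ?invr_gt0 ?exprn_gt0//.
    by rewrite -(sum_ordered c ltC); apply: sum_subset_le; apply/finset.bigcupsP.
  exact: sum_mass_le.
rewrite normrM ger0_norm ?invr_ge0// /depth_bound exprS invfM -mulrA.
move: massB massC; lra.
Qed.

End Mass.

(** The gap relation is transitive through elements with [lo u <= hi u], as holds for nonempty sets
    and for nonzero vectors. *)
Lemma sorted_gap_pairwise (T : eqType) (lo hi : T -> nat) (s : seq T) :
  (forall u, u \in s -> (lo u <= hi u)%N) ->
  sorted (fun u v => hi u < lo v)%N s = pairwise (fun u v => hi u < lo v)%N s.
Proof.
move=> lohi; apply: (@sorted_pairwise_in _ (mem s)); last exact/allP.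
move=> v u w vs _ _ uv vw; exact: ltn_trans (leq_trans uv (lohi v vs)) vw.
Qed.

(** * Supports, blocks, pairing and restriction *)

Section Supports.
Variable R : realType.
Implicit Types f g x : R^nat.

Lemma c00P x : c00 R x <-> x 0%N = 0 /\ exists K, forall i, (K <= i)%N -> x i = 0.
Proof.
split=> [[x0 finx]|[x0 [K xK]]].
  split=> //; exists (maxsupp x).+1 => i; apply: contraTeq => xi.
  by rewrite -leqNgt; apply: leq_fmax; rewrite in_fset_set// inE.
split=> //; apply: sub_finite_set (finite_II K) => i /=; apply: contraNT.
by rewrite -leqNgt => /xK ->.
Qed.

Lemma minsupp_leq x i : c00 R x -> x i != 0 -> (minsupp x <= i)%N.
Proof. by case=> _ finx xi; apply: fmin_leq; rewrite in_fset_set// inE. Qed.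

Lemma leq_maxsupp x i : c00 R x -> x i != 0 -> (i <= maxsupp x)%N.
Proof. by case=> _ finx xi; apply: leq_fmax; rewrite in_fset_set// inE. Qed.

Lemma minsupp_gt0 x : c00 R x -> supp x != fset0 -> (0 < minsupp x)%N.
Proof.
move=> [x0 finx] /fmin_in; rewrite in_fset_set// inE /= lt0n -/(minsupp x) => xm.
by apply: contraNneq xm => ->; rewrite x0.
Qed.

Lemma minsupp_leq_maxsupp x : supp x != fset0 -> (minsupp x <= maxsupp x)%N.
Proof. by move=> /fmin_in; exact: leq_fmax. Qed.

Lemma block_pairwise (s : seq R^nat) : block s =
  all (fun x => supp x != fset0) s &&
  pairwise (fun x y => maxsupp x < minsupp y)%N s.
Proof.
rewrite /block; case: allP => //= s0; apply: sorted_gap_pairwise => u /s0.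
exact: minsupp_leq_maxsupp.
Qed.

Lemma block_subseq (s t : seq R^nat) : subseq t s -> block s -> block t.
Proof.
move=> ts; rewrite !block_pairwise => /andP[/allP s0 ps].
rewrite (subseq_pairwise ts ps) andbT; apply/allP => u /(mem_subseq ts); exact: s0.
Qed.

Lemma block_lt (s : seq R^nat) f g : block s -> f \in s -> g \in s ->
  (minsupp f < minsupp g)%N -> (maxsupp f < minsupp g)%N.
Proof.
rewrite block_pairwise => /andP[/allP s0 /(pairwiseP 0) ps] fs gs fg.
have := ps (index f s) (index g s); rewrite !inE !index_mem !nth_index// => /(_ fs gs).
have := ps (index g s) (index f s); rewrite !inE !index_mem !nth_index// => /(_ gs fs).
have := minsupp_leq_maxsupp (s0 _ gs).
case: (ltngtP (index f s) (index g s)) => [_|_|].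
- by move=> _ _ /(_ isT).
- by move=> ? /(_ isT); lia.
- by move/(congr1 (nth 0 s)); rewrite !nth_index// => fgE; move: fg; rewrite fgE ltnn.
Qed.

(** Minima increase strictly along a block. This turns the S_1 condition on the set of minima into a
    bound on the number of vectors. *)
Lemma block_size (s : seq R^nat) : block s ->
  #|` [fset minsupp f | f in s]%fset| = size s.
Proof.
move=> bs; have -> : [fset minsupp f | f in s]%fset = [fset i in map (@minsupp R) s]%fset.
  apply/fsetP => i; rewrite !inE; apply/imfsetP/mapP => -[f /= fs ->]; by exists f.
rewrite card_fseq undup_id ?size_map//; apply: (sorted_uniq ltn_trans ltnn).
apply: pairwise_sorted; rewrite pairwise_map.
move: bs; rewrite block_pairwise => /andP[/allP s0].
apply: (sub_in_pairwise (P := mem s)) => [u v us vs|]; last exact/allP.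
exact: leq_ltn_trans (minsupp_leq_maxsupp (s0 u us)).
Qed.

(** Supports in a block are disjoint, so at most one term is nonzero at [i]. *)
Lemma block_sum_le1 (s : seq R^nat) i : block s ->
  (forall f, f \in s -> c00 R f /\ `|f i| <= 1) -> `|\sum_(f <- s) f i| <= 1.
Proof.
rewrite block_pairwise => /andP[_]; elim: s => [|f s IH].
  by rewrite big_nil normr0 ler01.
rewrite pairwise_cons big_cons => /andP[/allP fs ps] hs.
have [cf fi1] := hs f (mem_head _ _).
have hs' g : g \in s -> c00 R g /\ `|g i| <= 1 by move=> gs; apply: hs; rewrite inE gs orbT.
have [->|fi0] := eqVneq (f i) 0; first by rewrite add0r IH.
rewrite big_seq big1 ?addr0// => g gs; apply/eqP; rewrite -[_ == _]negbK; apply/negP => gi0.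
have := leq_trans (leq_ltn_trans (leq_maxsupp cf fi0) (fs g gs)).
by move=> /(_ _ (minsupp_leq (hs' g gs).1 gi0)); rewrite ltnn.
Qed.

Lemma sum_fctE (I : Type) (r : seq I) (P : pred I) (F : I -> R^nat) i :
  (\sum_(j <- r | P j) F j) i = \sum_(j <- r | P j) F j i.
Proof. by elim/big_rec2: _ => // j u v _ <-. Qed.

Lemma scale_fctE (a : R) f i : (a *: f) i = a * f i. Proof. by []. Qed.

Lemma add_fctE f g i : (f + g) i = f i + g i. Proof. by []. Qed.

Lemma pairing_ord K f x : (forall i, (K <= i)%N -> x i = 0) ->
  pairing f x = \sum_(i < K) f i * x i.
Proof.
move=> xK; rewrite (fsbig_ord _ K (fun i => f i * x i)) /pairing.
apply: esym; apply: fsbig_widen => // i [_ /= /negP]; rewrite -leqNgt => /xK ->.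
by rewrite mulr0.
Qed.

Lemma pairing_neq0 f x : pairing f x != 0 -> exists i, f i != 0 /\ x i != 0.
Proof.
move=> fx; apply: contrapT => nfx; move: fx; rewrite /pairing fsbig1 ?eqxx// => i _.
apply/eqP; rewrite -[_ == _]negbK mulf_eq0 negb_or; apply/negP => /andP[fi xi].
by apply: nfx; exists i.
Qed.

Lemma pairing_suml (I : Type) (r : seq I) (P : pred I) (F : I -> R^nat) x : c00 R x ->
  pairing (\sum_(j <- r | P j) F j) x = \sum_(j <- r | P j) pairing (F j) x.
Proof.
move=> /c00P[_ [K xK]]; under [RHS]eq_bigr do rewrite (pairing_ord _ xK).
rewrite (pairing_ord _ xK) exchange_big/=; apply: eq_bigr => i _.
by rewrite sum_fctE mulr_suml.
Qed.

Lemma pairingZl (a : R) f x : pairing (a *: f) x = a * pairing f x.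
Proof.
rewrite /pairing mulr_fsumr; apply: eq_fsbigr => i _; exact: esym (mulrA _ _ _).
Qed.

Lemma pairingNl f x : pairing (- f) x = - pairing f x.
Proof. by rewrite -scaleN1r pairingZl mulN1r. Qed.

Lemma pairing_sumr (I : finType) (P : pred I) f (a : I -> R) (X : I -> R^nat) :
  (forall j, c00 R (X j)) ->
  pairing f (\sum_(j | P j) a j *: X j) = \sum_(j | P j) a j * pairing f (X j).
Proof.
move=> cX; have /choice[K XK] : forall j, exists K, forall i, (K <= i)%N -> X j i = 0.
  by move=> j; have /c00P[] := cX j.
have XM j i : (\max_j K j <= i)%N -> X j i = 0.
  by move=> Ki; apply: XK; apply: leq_trans Ki; exact: leq_bigmax.
under [RHS]eq_bigr do rewrite (pairing_ord _ (XM _)) mulr_sumr.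
rewrite (@pairing_ord (\max_j K j)%N); last first.
  by move=> i Ki; rewrite sum_fctE big1// => j _; rewrite scale_fctE XM ?mulr0.
rewrite [RHS]exchange_big/=; apply: eq_bigr => i _; rewrite sum_fctE mulr_sumr.
by apply: eq_bigr => j _; rewrite scale_fctE mulrCA.
Qed.

Lemma restrZ I (a : R) f : restr I (a *: f) = a *: restr I f.
Proof.
by apply/funext => i; rewrite scale_fctE /restr; case: ifP; rewrite ?mulr0.
Qed.

Lemma restrN I f : restr I (- f) = - restr I f.
Proof. by rewrite -scaleN1r restrZ scaleN1r. Qed.

Lemma restr_sum (J : Type) (r : seq J) (P : pred J) (F : J -> R^nat) I :
  restr I (\sum_(j <- r | P j) F j) = \sum_(j <- r | P j) restr I (F j).
Proof.
apply/funext => i; rewrite sum_fctE /restr sum_fctE.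
by case: ifP => // _; rewrite big1.
Qed.

Lemma restr_restr I J f : restr I (restr J f) = restr (I `&` J)%O f.
Proof. by apply/funext => i; rewrite /restr in_itvI; case: (i \in I). Qed.

Lemma restr_full f : restr `]-oo, +oo[ f = f.
Proof. by apply/funext => i. Qed.

Lemma c00_sum (I : Type) (r : seq I) (P : pred I) (F : I -> R^nat) :
  (forall j, P j -> c00 R (F j)) -> c00 R (\sum_(j <- r | P j) F j).
Proof.
move=> cF; elim/big_rec: _ => [|j f Pj /c00P[f0 [K fK]]]; apply/c00P.
  by split=> //; exists 0%N.
have /c00P[g0 [L gL]] := cF j Pj; split; first by rewrite add_fctE f0 g0 addr0.
exists (maxn K L) => i; rewrite geq_max => /andP[Ki Li].
by rewrite add_fctE fK// gL// addr0.
Qed.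

Lemma c00Z (a : R) f : c00 R f -> c00 R (a *: f).
Proof.
move=> /c00P[f0 [K fK]]; apply/c00P; split; first by rewrite scale_fctE f0 mulr0.
by exists K => i Ki; rewrite scale_fctE fK ?mulr0.
Qed.

Lemma c00_restr I f : c00 R f -> c00 R (restr I f).
Proof.
move=> /c00P[f0 [K fK]]; apply/c00P; split; first by rewrite /restr f0 if_same.
by exists K => i Ki; rewrite /restr fK// if_same.
Qed.

Lemma c00_unitv n : (0 < n)%N -> c00 R (unitv R n).
Proof.
move=> n0; apply/c00P; split; first by rewrite /unitv eq_sym gtn_eqF.
by exists n.+1 => i ni; rewrite /unitv gtn_eqF.
Qed.

End Supports.

(** * Closure of W and finiteness of the norm *)

Section NormingSet.
Variables (R : realType) (D : coding_data R).
Implicit Types (f g x : R^nat) (V : set R^nat).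

Lemma typeI_head_sub (avg avg' : nat -> R^nat -> Prop) n f :
  (forall k a, avg k a -> avg' k a) -> typeI_head avg n f -> typeI_head avg' n f.
Proof.
move=> sub [n0 [s [savg adm vfg fE]]]; split=> //; exists s; split=> // u us.
exact/sub/savg.
Qed.

Lemma alpha_average_sub V V' n a : V `<=` V' ->
  alpha_average V n a -> alpha_average V' n a.
Proof.
move=> sub [n0 Va [fs [sz fsV bfs aE]]]; split=> //; first exact: sub.
by exists fs; split=> // f /fsV /sub.
Qed.

Lemma typeI_alpha_sub V V' n g : V `<=` V' ->
  typeI_alpha V n g -> typeI_alpha V' n g.
Proof.
move=> sub [f [I [hf fg]]]; exists f, I; split=> //; apply: typeI_head_sub hf.
by move=> k a; exact: alpha_average_sub.
Qed.

Lemma typeII_head_sub V V' s f : V `<=` V' ->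
  typeII_head D V s f -> typeII_head D V' s f.
Proof.
move=> sub [[bs sV L1s sg] adm fE]; split=> //; split=> // u /sV[Vu Iu].
by split; [exact: sub|exact: typeI_alpha_sub Iu].
Qed.

Lemma beta_average_sub V V' n b : V `<=` V' ->
  beta_average D V n b -> beta_average D V' n b.
Proof.
move=> sub [n0 Vb [d [f [w [dn fV tw bE]]]]]; split=> //; first exact: sub.
exists d, f, w; split=> // j; have [Vf [s [h [I [hh hI wE]]]]] := fV j.
by split; [exact: sub|exists s, h, I; split=> //; exact: typeII_head_sub hh].
Qed.

Lemma W_closed V : norming_closed D V -> W D `<=` V.
Proof. by move=> cV; apply: smallest_sub. Qed.

Lemma W_inter f : (forall V, norming_closed D V -> V f) -> W D f.
Proof. by move=> fV V [cV _]; exact: fV. Qed.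

(** A concrete set closed under all the rules, hence containing W. It shows that W lies in c00 and
    that the values f(x) are bounded, so that the [sup] in [Xnorm] is a genuine supremum. *)
Definition coord_le1 : set R^nat := [set f | c00 R f /\ forall i, `|f i| <= 1].

Lemma coord_le1_block (a : R) (s : seq (R^nat * nat)) : 0 <= a <= 1 ->
  block (unzip1 s) -> (forall u, u \in s -> coord_le1 u.1) ->
  coord_le1 (a *: \sum_(u <- s) u.1).
Proof.
move=> /andP[a0 a1] bs hs; split.
  by rewrite big_seq; apply/c00Z/c00_sum => u us; have [] := hs u us.
move=> i; rewrite scale_fctE normrM sum_fctE -(big_map fst xpredT (fun g : R^nat => g i)).
rewrite (ger0_norm a0) mulr_ile1//; apply: block_sum_le1 => // g /mapP[u us ->].
by have [cu] := hs u us.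
Qed.

Lemma typeI_head_coord_le1 (avg : nat -> R^nat -> Prop) n f :
  (forall k a, avg k a -> coord_le1 a) -> typeI_head avg n f -> coord_le1 f.
Proof.
move=> sub [n0 [s [savg [bs _] _ ->]]]; apply: coord_le1_block => //.
  by rewrite invr_ge0 exprn_ge0//= invf_le1 ?exprn_gt0// exprn_ege1// ler1n.
by move=> u /savg/sub.
Qed.

Lemma coord_le1_closed : norming_closed D coord_le1.
Proof.
have opp f : coord_le1 f -> coord_le1 (- f).
  move=> [cf f1]; split; first by rewrite -scaleN1r; exact: c00Z.
  by move=> i; rewrite -scaleN1r scale_fctE mulN1r normrN.
have unit n : (0 < n)%N -> coord_le1 (unitv R n).
  move=> n0; split; first exact: c00_unitv.
  by move=> i; rewrite /unitv; case: eqP; rewrite ?normr1 ?normr0 ?ler01.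
split=> //.
- by move=> f [].
- by move=> n n0; split; [|apply: opp]; exact: unit.
- move=> I f [cf f1]; split; first exact: c00_restr.
  by move=> i; rewrite /restr; case: ifP; rewrite ?normr0 ?ler01.
- move=> d q f q0 q1 hf; split; first by apply: c00_sum => j _; apply/c00Z/(hf j).1.
  move=> i; rewrite sum_fctE; apply: le_trans (ler_norm_sum _ _ _) _.
  have -> : 1 = \sum_j ratr (q j) :> R by rewrite -rmorph_sum q1 rmorph1.
  apply: ler_sum => j _.
  by rewrite scale_fctE normrM ger0_norm ?ler0q// ler_piMr ?ler0q// (hf j).2.
- by move=> n f; apply: typeI_head_coord_le1 => k a [].
- by move=> n f; apply: typeI_head_coord_le1 => k a [].
- move=> s f [[bs sV _ _] _ ->]; apply: coord_le1_block => //.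
    by rewrite invr_ge0 ler0n/= invf_le1// ler1n.
  by move=> u /sV[].
Qed.

(** W is the intersection of all closed sets. The rules are monotone in V, so a functional built
    over W is also built over each closed V and lies in it. *)
Lemma W_norming : norming_closed D (W D).
Proof.
split.
- by move=> f /(W_closed coord_le1_closed)[].
- by move=> n n0; split; apply: W_inter => V cV; have [] := closed_unit cV n0.
- by move=> f Wf; apply: W_inter => V cV; apply: (closed_opp cV); exact: W_closed Wf.
- by move=> I f Wf; apply: W_inter => V cV; apply: (closed_restr cV); exact: W_closed Wf.
- move=> d q f q0 q1 Wf; apply: W_inter => V cV; apply: (closed_conv cV) => // j.
  exact: W_closed (Wf j).
- move=> n f Wf; apply: W_inter => V cV; apply: (closed_Ialpha cV (n := n)).
  by apply: typeI_head_sub Wf => k a; apply: alpha_average_sub; exact: W_closed.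
- move=> n f Wf; apply: W_inter => V cV; apply: (closed_Ibeta cV (n := n)).
  by apply: typeI_head_sub Wf => k a; apply: beta_average_sub; exact: W_closed.
- move=> s f Wf; apply: W_inter => V cV; apply: (closed_II cV (s := s)).
  by apply: typeII_head_sub Wf; exact: W_closed.
Qed.

Lemma pairing_le_Xnorm f x : c00 R x -> W D f -> pairing f x <= Xnorm D x.
Proof.
move=> /c00P[_ [K xK]] Wf; apply: ub_le_sup; last by exists f.
exists (\sum_(i < K) `|x i|) => _ [g /(W_closed coord_le1_closed)[_ g1] <-].
rewrite (pairing_ord _ xK); apply: le_trans (ler_norm _) _.
apply: le_trans (ler_norm_sum _ _ _) _; apply: ler_sum => i _.
by rewrite normrM ler_piMl.
Qed.

Lemma Xnorm_le x r : (forall f, W D f -> pairing f x <= r) -> Xnorm D x <= r.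
Proof.
move=> fr; apply: ge_sup; last by move=> _ [f Wf <-]; exact: fr.
by have [We _] := closed_unit W_norming (ltn0Sn 0); exists (pairing (unitv R 1) x), (unitv R 1).
Qed.

Lemma abs_pairing_le_Xnorm f x : c00 R x -> W D f -> `|pairing f x| <= Xnorm D x.
Proof.
move=> cx Wf; rewrite ler_norml lerNl -pairingNl !pairing_le_Xnorm//.
exact: closed_opp W_norming _ Wf.
Qed.

(** * The depth bound for every functional in W *)

Variables (m : nat) (c : 'I_m -> R) (x : 'I_m -> R^nat).
Hypotheses (c_ge0 : forall k, 0 <= c k) (cx : forall k, c00 R (x k)).
Hypothesis x_neq0 : forall k, supp (x k) != fset0.
Hypothesis x_block : forall k l : 'I_m, (k < l)%N -> (maxsupp (x k) < minsupp (x l))%N.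
Hypothesis x_le1 : forall k, Xnorm D (x k) <= 1.

Let p k := minsupp (x k).

Let p_gt0 k : (0 < p k)%N. Proof. exact: minsupp_gt0. Qed.

(** The induction predicate over W. Quantifying over I makes it stable under restriction;
    quantifying over n and A lets the half-sum step call it at lower depth on smaller index sets.
    Membership in W gives |f(x_k)| <= 1. *)
Definition good f : Prop := W D f /\ forall I n (A : {set 'I_m}),
  `|\sum_(k in A) c k * pairing (restr I f) (x k)| <= depth_bound p c n A.

Lemma pairing_restr_le1 f I k : W D f -> `|pairing (restr I f) (x k)| <= 1.
Proof.
move=> Wf; apply: le_trans (x_le1 k); apply: abs_pairing_le_Xnorm => //.
exact: closed_restr W_norming _ _ Wf.
Qed.

(** Thresholds [a j] in place of min supp [g j] avoid computing the support of a sum when [g j] is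
    an inner node of a tree. *)
Lemma good_half d (a : 'I_d -> nat) (g : 'I_d -> R^nat) :
  (forall j, good (g j)) -> (forall j, (d <= a j)%N) ->
  (forall j i, g j i != 0 ->
     (a j <= i)%N /\ forall j' : 'I_d, (j < j')%N -> (i < a j')%N) ->
  W D (2^-1 *: \sum_j g j) -> good (2^-1 *: \sum_j g j).
Proof.
move=> gg da ga Wg; split=> // I n A.
have gE k : pairing (restr I (2^-1 *: \sum_j g j)) (x k) =
    2^-1 * \sum_j pairing (restr I (g j)) (x k).
  by rewrite restrZ pairingZl restr_sum pairing_suml.
under eq_bigr do rewrite gE.
apply: (depth_bound_half c_ge0 p_gt0 x_block da).
- move=> j k /pairing_neq0[i [gi xi]].
  have /ga[ai ia] : g j i != 0 by move: gi; rewrite /restr; case: ifP; rewrite ?eqxx.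
  split; first exact: leq_trans ai (leq_maxsupp (cx k) xi).
  move=> j' /ia; apply: leq_ltn_trans; exact: minsupp_leq (cx k) xi.
- by move=> k; rewrite -gE; exact: pairing_restr_le1.
- by move=> j n' A'; have [_] := gg j; apply.
Qed.

Lemma good_schreier1 (s : seq R^nat) : block s -> (forall f, f \in s -> good f) ->
  schreier 1 [fset minsupp f | f in s]%fset ->
  W D (2^-1 *: \sum_(f <- s) f) -> good (2^-1 *: \sum_(f <- s) f).
Proof.
move=> bs gs [_]; rewrite block_size// => szs.
rewrite (big_nth 0) big_mkord; apply: (@good_half _ (fun j => minsupp s`_j)) => [j|j|j i si].
- by apply: gs; exact: mem_nth.
- apply: leq_trans szs _; apply: fmin_leq; apply/imfsetP; exists s`_j => //=.
  exact: mem_nth.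
- have js : s`_j \in s by exact: mem_nth.
  have cj : c00 R s`_j by apply: (closed_c00 W_norming); have [] := gs _ js.
  split; first exact: minsupp_leq.
  move=> j' jj'; apply: leq_ltn_trans (leq_maxsupp cj si) _.
  by move: bs; rewrite block_pairwise => /andP[_ /(pairwiseP 0)]; apply; rewrite ?inE.
Qed.

(* A functional of weight n is a tree of height n of half-sums over S_1-admissible
   families, whose inner nodes are again functionals of lower weight and lie in W. *)
Lemma good_schreier n (s : seq R^nat) : block s -> (forall f, f \in s -> good f) ->
  (forall k t, (0 < k)%N -> subseq t s -> schreier k [fset minsupp f | f in t]%fset ->
     W D (2 ^- k *: \sum_(f <- t) f)) ->
  schreier n.+1 [fset minsupp f | f in s]%fset ->
  good (2 ^- n.+1 *: \sum_(f <- s) f).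
Proof.
elim: n s => [|n IH] s bs gs Ws schs.
  have := Ws 1%N s isT (subseq_refl s) schs.
  by rewrite expr1; exact: good_schreier1.
have := Ws _ s (ltn0Sn _) (subseq_refl s) schs.
case: schs => Fs [Fs0 sFs schFs szFs sFsE].
have {}schFs G : G \in Fs -> schreier n.+1 G := schFs G.
have pFs : pairwise (fun G H => fmax G < fmin H)%N Fs.
  rewrite -sorted_gap_pairwise// => G GFs; apply/leq_fmax/fmin_in.
  exact: schreier_neq0 (schFs G GFs).
pose d := size Fs; pose F (j : 'I_d) := nth fset0 Fs j.
have FFs j : F j \in Fs by exact: mem_nth.
have ltF (i j : 'I_d) : (i < j)%N -> (fmax (F i) < fmin (F j))%N.
  by move: pFs => /(pairwiseP fset0); apply; rewrite inE.
have Fs_s i j : i \in F j -> exists2 f, f \in s & i = minsupp f.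
  move=> iF; have : i \in [fset minsupp f | f in s]%fset.
    by rewrite sFsE; apply/bigfcupP; exists (F j); rewrite ?FFs.
  by case/imfsetP => f; exists f.
(* The children of the root: [g j] collects the functionals whose minimum lies in [F j]. The F_j are
   successive, so every member of [s] belongs to exactly one child. *)
pose g j := 2 ^- n.+1 *: \sum_(f <- [seq f <- s | minsupp f \in F j]) f : R^nat.
have <- : 2^-1 *: \sum_j g j = 2 ^- n.+2 *: \sum_(f <- s) f.
  rewrite /g -scaler_sumr scalerA -invfM -exprS; congr (_ *: _).
  under eq_bigr do rewrite big_filter big_mkcond/=.
  rewrite exchange_big/=; apply: eq_big_seq => f fs.
  have : minsupp f \in [fset minsupp f | f in s]%fset by apply/imfsetP; exists f.
  rewrite sFsE => /bigfcupP[G /andP[/(nthP fset0)[j jd <-] _] fG].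
  rewrite (bigD1 (Ordinal jd))//= fG big1 ?addr0// => i ij.
  case: ifPn => // fF; have := leq_fmax fF; have := leq_fmax fG.
  have := fmin_leq fF; have := fmin_leq fG; rewrite -/(F (Ordinal jd)).
  case: (ltngtP i j) ij => [ij|ji|ij]; last by rewrite -val_eqE /= ij eqxx.
    by have /= := ltF i (Ordinal jd) ij; lia.
  by have /= := ltF (Ordinal jd) i ji; lia.
apply: (@good_half _ (fun j => fmin (F j))) => [j|j|j i].
- apply: IH.
  + exact: block_subseq (filter_subseq _ _) bs.
  + by move=> f; rewrite mem_filter => /andP[_]; exact: gs.
  + by move=> k t k0 ts; apply: Ws k0 (subseq_trans ts (filter_subseq _ _)).
  + rewrite [X in schreier _ X](_ : _ = F j); first exact: schFs.
    apply/fsetP => i; apply/imfsetP/idP => /= [[f + ->]|iF].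
      by rewrite mem_filter => /andP[].
    by have [f fs iE] := Fs_s _ _ iF; exists f => //; rewrite mem_filter -iE iF.
(* The Schreier condition bounds d by the minimum of the first F_j only; the later minima are
   larger. *)
- apply: leq_trans szFs _; rewrite -nth0.
  case: j => -[|j] jd //.
  have sz0 : (0 < d)%N by exact: ltn_trans jd.
  apply: leq_trans (ltnW (ltF (Ordinal sz0) (Ordinal jd) isT)).
  by apply/leq_fmax/fmin_in; apply: schreier_neq0 (schFs _ _); exact: mem_nth.
- rewrite /g scale_fctE mulf_eq0 negb_or => /andP[_]; rewrite sum_fctE => gi.
  have [f [fs fF fi]] : exists f, [/\ f \in s, minsupp f \in F j & f i != 0].
    apply: contrapT => nf; move: gi; rewrite big_filter big_seq_cond big1 ?eqxx//.
    move=> f /andP[fs fF]; apply/eqP; rewrite -[_ == _]negbK; apply/negP => fi.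
    by apply: nf; exists f.
  have cf : c00 R f by apply: (closed_c00 W_norming); have [] := gs _ fs.
  split; first exact: leq_trans (fmin_leq fF) (minsupp_leq cf fi).
  move=> j' jj'; apply: leq_ltn_trans (leq_maxsupp cf fi) _.
  have := ltF _ _ jj'; have : fmin (F j') \in F j'.
    (* The minimum of [F j'] is min supp of some f' in [s], and the block property places f' after
       the whole support of f. *)
    by apply/fmin_in; apply: schreier_neq0 (schFs _ _); exact: FFs.
  case/Fs_s => f' f's -> Fj; apply: (block_lt bs fs f's).
  exact: leq_ltn_trans (leq_fmax fF) Fj.
Qed.

(** Serves both kinds of averages. Inner nodes of the tree are heads over subsequences, which stay
    very fast growing because the sizes increase: a lower bound on one size passes to all later
    ones. *)
Lemma good_typeI (avg : nat -> R^nat -> Prop) n f :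
  (forall k a, avg k a -> good a) -> (forall k h, typeI_head avg k h -> W D h) ->
  typeI_head avg n f -> good f.
Proof.
move=> avg_good avg_W [n0 [s [savg [bs schs] vfg ->]]].
rewrite -(prednK n0) -(big_map fst xpredT id); apply: good_schreier => //.
- by move=> f' /mapP[u /savg/avg_good + ->].
- move=> k t k0 /subseqP[b _ ->] scht; rewrite -map_mask big_map; apply: (avg_W k).
  split=> //; exists (mask b s); split=> //.
  + by move=> u /mem_mask; exact: savg.
  + by split; rewrite /unzip1 map_mask//; apply: block_subseq bs; exact: mask_subseq.
  + case/andP: vfg => bs' vfg; apply/andP; split.
      by rewrite /unzip1 map_mask; apply: block_subseq bs'; exact: mask_subseq.
    apply: subseq_sorted vfg; last exact: mask_subseq.
    by move=> v u w /andP[uv uv'] /andP[_ vw]; rewrite (ltn_trans uv vw) (ltn_trans uv' vw).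
- by rewrite prednK.
Qed.

(** A single position is an S_0 set, so its coefficient is already counted by the mass. *)
Lemma depth_bound_ge_coef n (A : {set 'I_m}) k : k \in A -> c k <= depth_bound p c n A.
Proof.
move=> kA; have -> : c k = \sum_(l in [set k]%SET) c l by rewrite big_set1.
have small_k : small p 0 [set k]%SET.
  right; exists (p k); rewrite ?p_gt0//; apply/fsetP => i; rewrite inE.
  apply/imfsetP/eqP => [[l /= + ->]|->]; first by rewrite inE => /eqP->.
  by exists k; rewrite //= inE.
have k_A : [set k]%SET \subset A by rewrite finset.sub1set.
apply: le_trans (le_mass c k_A small_k) _.
apply: le_trans (mass_le c p_gt0 A (leq0n n)) _.
have := mass_ge0 p c_ge0 n A.
have : 0 <= 2 ^- n * \sum_(l in A) c l.
  by rewrite mulr_ge0 ?invr_ge0 ?exprn_ge0// sumr_ge0.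
rewrite /depth_bound; lra.
Qed.

Lemma depth_bound_ge0 n (A : {set 'I_m}) : 0 <= depth_bound p c n A.
Proof.
by rewrite addr_ge0 ?mulr_ge0 ?invr_ge0 ?exprn_ge0 ?mass_ge0// sumr_ge0.
Qed.

Lemma good_opp f : good f -> good (- f).
Proof.
move=> [Wf gf]; split; first exact: closed_opp W_norming _ Wf.
move=> I n A; under eq_bigr do rewrite restrN pairingNl mulrN.
by rewrite sumrN normrN.
Qed.

(** The x_k have disjoint supports, so e_n acts on at most one of them and a single coefficient
    remains. *)
Lemma good_unitv n : (0 < n)%N -> good (unitv R n).
Proof.
move=> n0; have [We _] := closed_unit (W_norming) n0; split=> // I k A.
have pair0 l : x l n = 0 -> pairing (restr I (unitv R n)) (x l) = 0.
  move=> xl; apply/eqP; rewrite -[_ == _]negbK; apply/negP => /pairing_neq0[i []].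
  rewrite /restr /unitv; case: ifP => _; last by rewrite eqxx.
  by case: (i =P n) => [->|_]; rewrite ?xl eqxx.
have [[l lA xl]|nA] := pselect (exists2 l, l \in A & x l n != 0); last first.
  rewrite big1 ?normr0 ?depth_bound_ge0// => l lA; rewrite pair0 ?mulr0//.
  by apply/eqP; rewrite -[_ == _]negbK; apply/negP => xl; apply: nA; exists l.
rewrite (bigD1 l)//= big1 ?addr0; last first.
  move=> l' /andP[_ ll']; rewrite pair0 ?mulr0//.
  apply/eqP; rewrite -[_ == _]negbK; apply/negP => xl'.
  have := leq_maxsupp (cx l) xl; have := minsupp_leq (cx l) xl.
  have := leq_maxsupp (cx l') xl'; have := minsupp_leq (cx l') xl'.
  case: (ltngtP l l') ll' => [/x_block|/x_block|/val_inj->]; [lia|lia|].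
  by rewrite eqxx.
rewrite normrM ger0_norm//; apply: le_trans (depth_bound_ge_coef k lA).
by rewrite ler_piMr// pairing_restr_le1.
Qed.

Lemma good_norming : norming_closed D good.
Proof.
have goodW : good `<=` W D by move=> f [].
split.
- by move=> f /goodW/(closed_c00 W_norming).
- by move=> n n0; split; [|apply: good_opp]; exact: good_unitv.
- exact: good_opp.
- move=> I f [Wf gf]; split; first exact: closed_restr W_norming _ _ Wf.
  by move=> J n A; rewrite restr_restr.
- move=> d r f r0 r1 gf; split.
    by apply: (closed_conv W_norming) => // j; apply: goodW.
  move=> I n A.
  have -> : \sum_(k in A) c k * pairing (restr I (\sum_j ratr (r j) *: f j)) (x k) =
      \sum_j ratr (r j) * \sum_(k in A) c k * pairing (restr I (f j)) (x k).
    under eq_bigr do rewrite restr_sum pairing_suml// mulr_sumr.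
    rewrite exchange_big/=; apply: eq_bigr => j _; rewrite mulr_sumr.
    by apply: eq_bigr => k _; rewrite restrZ pairingZl mulrCA.
  apply: le_trans (ler_norm_sum _ _ _) _.
  have -> : depth_bound p c n A = \sum_j ratr (r j) * depth_bound p c n A.
    by rewrite -mulr_suml -rmorph_sum r1 rmorph1 mul1r.
  apply: ler_sum => j _; rewrite normrM ger0_norm ?ler0q// ler_wpM2l ?ler0q//.
  by have [_] := gf j; apply.
(* An average relative to [good] is by definition a member of [good], so the tree argument starts
   from good leaves. *)
- move=> n f; apply: (@good_typeI (alpha_average good)); first by move=> k a [].
  move=> k h hh; apply: (closed_Ialpha W_norming (n := k)).
  by apply: typeI_head_sub hh => l a; exact: alpha_average_sub.
- move=> n f; apply: (@good_typeI (beta_average D good)); first by move=> k a [].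
  move=> k h hh; apply: (closed_Ibeta W_norming (n := k)).
  by apply: typeI_head_sub hh => l a; exact: beta_average_sub.
- move=> s f fs; have := closed_II W_norming (typeII_head_sub goodW fs).
  case: fs => [[bs sg _ _] [_ schs] ->]; rewrite -(big_map fst xpredT id).
  by apply: good_schreier1 => // g /mapP[u /sg[gu _] ->].
Qed.

(** * From functionals to the norm, and the choice of depth *)

Lemma Xnorm_le_depth_bound n (A : {set 'I_m}) :
  Xnorm D (\sum_(k in A) c k *: x k) <= depth_bound p c n A.
Proof.
apply: Xnorm_le => f Wf; rewrite pairing_sumr//; apply: le_trans (ler_norm _) _.
by have [_ /(_ `]-oo, +oo[ n A)] := W_closed good_norming Wf; rewrite restr_full.
Qed.

End NormingSet.

Theorem corollary2p9 (R : realType) (D : coding_data R) (n : nat) (eps : R)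
    (m : nat) (c : 'I_m -> R) (x : 'I_m -> R^nat) :
  (0 < n)%N -> 0 < eps ->
  scc n eps c x ->
  (forall k, Xnorm D (x k) <= 1) ->
  (forall F : {set 'I_m},
     Xnorm D (\sum_(k in F) c k *: x k)
       <= 6 / 2 ^+ n * (\sum_(k in F) c k) + 12 * eps) /\
  Xnorm D (\sum_k c k *: x k) <= 6 / 2 ^+ n + 12 * eps.
Proof.
move=> n_gt0 eps_gt0 [cx bx [_ bc_ge0 bc_sum bc_small]] x_le1.
pose p k := minsupp (x k).
have [x_neq0 x_block] : (forall k, supp (x k) != fset0) /\
    forall k l : 'I_m, (k < l)%N -> (maxsupp (x k) < minsupp (x l))%N.
  move: bx; rewrite block_pairwise pairwise_map => /andP[/allP x0 px]; split.
    by move=> k; apply: x0; apply: map_f; rewrite mem_enum.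
  move=> k l kl; have /(pairwiseP k) := px; move=> /(_ k l).
  by rewrite !inE size_enum_ord !nth_ord_enum; apply.
have p_inj : injective p.
  move=> k l; case: (ltngtP k l) => [/x_block + E|/x_block + E|/val_inj//].
    by have := minsupp_leq_maxsupp (x_neq0 k); rewrite -/(p k) E /p; lia.
  by have := minsupp_leq_maxsupp (x_neq0 l); rewrite -/(p l) -E /p; lia.
(* Injectivity of [p] identifies the coordinates of the basic special convex combination with the
   c_k. *)
have cE k : (\sum_k c k *: unitv R (p k)) (p k) = c k.
  rewrite sum_fctE (bigD1 k)//= big1 ?addr0 => [|l lk].
    by rewrite scale_fctE /unitv eqxx mulr1.
  by rewrite scale_fctE /unitv (inj_eq p_inj) eq_sym (negbTE lk) mulr0.
have sumE (A : {set 'I_m}) :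
    \sum_(i <- [fset p k | k in A]%fset) (\sum_k c k *: unitv R (p k)) i = \sum_(k in A) c k.
  rewrite big_imfset /=; last by move=> ? ? _ _ /p_inj.
  by rewrite big_enum/=; apply: eq_bigr => k _; exact: cE.
have c_ge0 k : 0 <= c k.
  by rewrite -cE; apply: bc_ge0; apply/imfsetP; exists k.
have sumT (V : nmodType) (F : 'I_m -> V) : \sum_k F k = \sum_(k in [set: 'I_m]%SET) F k.
  by apply: eq_bigl => k; rewrite finset.in_setT.
have c_sum : \sum_k c k = 1.
  rewrite -bc_sum sumT -sumE; congr (\sum_(i <- enum_fset _) _).
  by apply/fsetP => i; apply/imfsetP/imfsetP => -[k _ ->]; exists k; rewrite //= finset.in_setT.
have p_gt0 k : (0 < p k)%N by exact: minsupp_gt0.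
have mass_eps (A : {set 'I_m}) : mass p c n.-1 A <= eps.
  have [_ [H0|sH]] := heavy_small p c n.-1 A; first by rewrite /mass H0 big_set0 ltW.
  rewrite /mass -sumE ltW// bc_small//.
  by apply/fsubsetP => i /imfsetP[k _ ->]; apply/imfsetP; exists k.
have main (F : {set 'I_m}) : Xnorm D (\sum_(k in F) c k *: x k) <=
    6 / 2 ^+ n * (\sum_(k in F) c k) + 12 * eps.
  (* Depth n - 1 gives 2/2^n times the coefficient sum plus 4 eps, a third of the claimed bound. *)
  apply: le_trans (Xnorm_le_depth_bound c_ge0 cx x_neq0 x_block x_le1 n.-1 F) _.
  have -> : 6 / 2 ^+ n * (\sum_(k in F) c k) = 3 * (2 ^- n.-1 * \sum_(k in F) c k).
    by rewrite -{1}(prednK n_gt0) exprS invfM; field.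
  have := mass_eps F; rewrite /depth_bound -/p.
  have : 0 <= 2 ^- n.-1 * \sum_(k in F) c k.
    by rewrite mulr_ge0 ?invr_ge0 ?exprn_ge0// sumr_ge0.
  lra.
split=> //; have := main [set: 'I_m]%SET.
by rewrite -!sumT c_sum mulr1.
Qed.
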